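(* Let $(M_n(x))_{n\ge 0}$ and $(N_n(x))_{n\ge 0}$ be the polynomials determined by $M_0(x)=N_0(x)=1$ and, for $n\ge 1$, $N_n(x)=nxM_{n-1}(x)+nN_{n-1}(x)$ and $M_n(x)=n(x+1)M_{n-1}(x)+nN_{n-1}(x)$. Then for all $n\ge 0$, $$N_n(x)=n!\sum_{k=0}^{n}\binom{n+k}{n-k}x^k.$$
   Context: $M_n(x)$ and $N_n(x)$ are polynomials in an indeterminate $x$ with real coefficients, defined by the simultaneous recurrence in the claim. *)

(* Defs.v *)
From mathcomp Require Import all_boot all_order all_algebra.
From mathcomp Require Import reals.

(* Main.v *)
Require Import Defs.
From mathcomp Require Import all_boot all_order all_algebra.
From mathcomp Require Import reals.
Import GRing.Theory.
Local Open Scope ring_scope.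

(** Up to the factor [n!], the two sequences are the Morgan-Voyce polynomials,
    and on coefficients their joint recurrence is Pascal's rule.  Subtracting
    the recurrences gives [M n.+1 = N n.+1 + n.+1 M n], so that with
    [N n = n! b_n] and [M n = n! B_n]
<<
      b_(n+1) = x B_n + b_n        and        B_(n+1) = b_(n+1) + B_n.
>>
    If the coefficient of [x^k] is ['C(n + k, 2k)] in [b_n] and
    ['C(n + k + 1, 2k + 1)] in [B_n], these two identities say exactly that an
    entry of Pascal's triangle is the sum of the two entries above it
    ([morgan_voyce_coef]).

    The lower index [2k], in place of the symmetric [n - k], is what makes the
    induction uniform in [k]: for [k > n] the binomial coefficients vanish by
    themselves, whereas the truncated [n - k] would be [0] and the binomial
    coefficient [1].  The symmetry of binomial coefficients is used only at the
    end, where the sum is restricted to [k <= n]. *)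

(** The coefficients of both sequences have to be found together, since each
    recurrence involves both. *)
Lemma morgan_voyce_coef (R : nzRingType) (M N : nat -> {poly R})
  (hM0 : M 0%N = 1) (hN0 : N 0%N = 1)
  (hN : forall n, N n.+1 = n.+1%:R *: ('X * M n + N n))
  (hM : forall n, M n.+1 = N n.+1 + n.+1%:R *: M n) (n k : nat) :
  (N n)`_k = (n`! * 'C(n + k, k.*2))%:R /\
  (M n)`_k = (n`! * 'C((n + k).+1, k.*2.+1))%:R.
Proof.
elim: n k => [|n IHn] k.
  rewrite hM0 hN0 coef1 !mul1n !add0n.
  case: k => [|k] /=; first by [].
  by rewrite !bin_small ?muln0 // doubleS !ltnS -addnn leq_addr.
have NE : (N n.+1)`_k = (n.+1`! * 'C(n.+1 + k, k.*2))%:R.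
  rewrite hN coefZ coefD coefXM factS -mulnA natrM; congr (_ * _).
  (* Pascal's rule at column [2k] needs column [2k - 1], absent when [k = 0]. *)
  case: k => [|k] /=; first by rewrite add0r (IHn 0%N).1 !bin0.
  rewrite (IHn k).2 (IHn k.+1).1 doubleS addSn addnS [in RHS]binS.
  by rewrite mulnDr natrD addrC.
split=> //.
rewrite hM coefD NE coefZ (IHn k).2 -natrM mulnA -factS -natrD -mulnDr.
by rewrite [in RHS]binS [in RHS](addnC 'C(_, _)).
Qed.

Theorem corollary3p3 (R : realType) (M N : nat -> {poly R})
  (hM0 : M 0%N = 1) (hN0 : N 0%N = 1)
  (hN : forall n : nat, (1 <= n)%N ->
     N n = n%:R *: ('X * M n.-1) + n%:R *: N n.-1)
  (hM : forall n : nat, (1 <= n)%N ->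
     M n = n%:R *: (('X + 1) * M n.-1) + n%:R *: N n.-1) :
  forall n : nat,
    N n = n`!%:R *: \sum_(0 <= k < n.+1) 'C(n + k, n - k)%:R *: 'X^k.
Proof.
move=> n.
have hN' m : N m.+1 = m.+1%:R *: ('X * M m + N m) by rewrite hN // scalerDr.
have hM' m : M m.+1 = N m.+1 + m.+1%:R *: M m.
  by rewrite (hM m.+1) // (hN m.+1) //= mulrDl mul1r scalerDr addrAC.
apply/polyP=> k; rewrite (morgan_voyce_coef _ _ _ hM0 hN0 hN' hM' n k).1.
rewrite big_mkord -(poly_def n.+1 (fun k => 'C(n + k, n - k)%:R)) coefZ coef_poly natrM ltnS; congr (_ * _).
case: leqP => [le_kn | lt_nk]; last by rewrite bin_small // -addnn ltn_add2r.
rewrite -bin_sub; last by rewrite -addnn leq_add2r.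
by rewrite -addnn subnDr.
Qed.
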